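(* Let $q$ be a prime power, $n\ge 1$ an integer, and let $\alpha\in \mathbb{F}_{q^n}$ have $\mathbb{F}_q$-order $f(x)=\sum_{i=0}^m a_i x^i\in\mathbb{F}_q[x]$ (with $a_m=1$). Then the $\mathbb{F}_q$-order of the additive character $\chi_\alpha$ equals $f^*(x)=a_0^{-1}x^m f(1/x)$, the monic reciprocal of $f$.
   Context: Let $q=p^s$ with $p$ prime, and $\mathbb{F}_{q^n}$ the degree-$n$ extension of $\mathbb{F}_q$. $\mathbb{F}_{q^n}$ is an $\mathbb{F}_q[x]$-module via $g\circ\alpha=\sum_{i} b_i\alpha^{q^i}$ for $g(x)=\sum_i b_i x^i\in\mathbb{F}_q[x]$. The $\mathbb{F}_q$-order $m_{\alpha,q}$ of $\alpha\in\mathbb{F}_{q^n}$ is the monic generator of the ideal $\{g\in\mathbb{F}_q[x]: g\circ\alpha=0\}$; it divides $x^n-1$ (so in particular its constant term $a_0$ is nonzero). For $a\in\mathbb{F}_{q^n}$, the additive character $\chi_a:\mathbb{F}_{q^n}\to\mathbb{C}^\times$ is $\chi_a(\beta)=\exp\left(2\pi i\,\mathrm{Tr}_{q^n/p}(a\beta)/p\right)$, where $\mathrm{Tr}_{q^n/p}(x)=\sum_{i=0}^{ns-1}x^{p^i}$; every additive character of $\mathbb{F}_{q^n}$ has this form, and $\chi_0$ is the trivial character. The additive characters form an $\mathbb{F}_q[x]$-module via $(g\circ\chi)(\beta)=\chi(g\circ\beta)$. The $\mathbb{F}_q$-order $\mathrm{Ord}(\chi)$ of a character $\chi$ is the monic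 generator of the ideal $\{g\in\mathbb{F}_q[x]: g\circ\chi=\chi_0\}$. *)

(* Defs.v *)
From HB Require Import structures.
From mathcomp Require Import all_boot all_order all_algebra all_field.
From mathcomp Require Import complex.
From mathcomp Require Import reals sequences trigo exp.

Set Implicit Arguments.
Unset Strict Implicit.
Unset Printing Implicit Defensive.

Import Order.TTheory GRing.Theory Num.Theory.
Local Open Scope ring_scope.
Local Open Scope complex_scope.

Definition cexp (R : realType) (z : R[i]) : R[i] :=
  (expR (complex.Re z))%:C * (cos (complex.Im z) +i* sin (complex.Im z)).

(* [m] is the monic generator of the ideal [I]; such an [m] is unique. *)
Definition monic_generator (F : fieldType) (I : {poly F} -> Prop)
    (m : {poly F}) : Prop :=
  m \is monic /\ forall g : {poly F}, I g <-> m %| g.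

Definition poly_act (F : finFieldType) (L : fieldExtType F)
    (g : {poly F}) (alpha : L) : L :=
  \sum_(i < size g) g`_i *: alpha ^+ (#|F| ^ i).

Definition has_Fq_order (F : finFieldType) (L : fieldExtType F)
    (alpha : L) (f : {poly F}) : Prop :=
  monic_generator (fun g => poly_act g alpha = 0) f.

(* For a field of order [p ^ N], this is the absolute trace, with its values
   seen in the prime subfield of [L] rather than in ['F_p]. *)
Definition abs_trace (L : fieldType) (p N : nat) (x : L) : L :=
  \sum_(i < N) x ^+ (p ^ i).

(* The integer [0 <= k < p] representing an element [t] of the prime subfield
   of a field of characteristic [p]; the default [0] only concerns elements
   outside the prime subfield. *)
Definition prime_residue (L : fieldType) (p : nat) (t : L) : nat :=
  if [pick k : 'I_p | k%:R == t] is Some k then k : nat else 0%N.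

(* Here the field has order [p ^ N]. *)
Definition add_char (R : realType) (L : fieldType) (p N : nat) (a : L)
    (beta : L) : R[i] :=
  cexp (((2 * pi : R)%:C * 'i%C * (prime_residue p (abs_trace p N (a * beta)))%:R)
        / p%:R).

Definition char_act (R : realType) (F : finFieldType) (L : fieldExtType F)
    (g : {poly F}) (chi : L -> R[i]) : L -> R[i] :=
  fun beta => chi (poly_act g beta).

(* The trivial character is constantly [1]. *)
Definition has_Fq_order_char (R : realType) (F : finFieldType)
    (L : fieldExtType F) (chi : L -> R[i]) (f : {poly F}) : Prop :=
  monic_generator (fun g => char_act g chi =1 (fun=> 1)) f.

(* With [m] the degree of [f], this is [a_0^-1 * x^m * f(1/x)]. *)
Definition monic_reciprocal (F : fieldType) (f : {poly F}) : {poly F} :=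
  (f`_0)^-1 *: \sum_(i < size f) f`_i *: 'X^((size f).-1 - i).

(* Main.v *)
(* Put q = #|F| and let T be the absolute trace of L. The values of T lie in the
   prime subfield, so chi_alpha(b) = 1 iff T(alpha b) = 0. Since T is invariant
   under b |-> b^q, which has finite order on L, the adjoint of b |-> g o b with
   respect to (a, b) |-> T(a b) is a |-> (x^M g(1/x)) o a for every multiple
   M >= deg g of [L : F]. As T is nondegenerate, g o chi_alpha is trivial iff
   (x^M g(1/x)) o alpha = 0, i.e. iff f divides x^M g(1/x). Finally f(0) != 0,
   because f divides x^[L : F] - 1, so reversal turns this condition into
   f^* divides g. *)
Require Import Defs.
From mathcomp Require Import all_boot all_order all_algebra all_field.
From mathcomp Require Import complex.
From mathcomp Require Import reals.
From mathcomp Require Import sequences trigo exp.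
From mathcomp Require Import lra.

Set Implicit Arguments.
Unset Strict Implicit.
Unset Printing Implicit Defensive.

Import Order.TTheory GRing.Theory Num.Theory.
Local Open Scope ring_scope.

Lemma sum_ord_trunc (V : nmodType) (G : nat -> V) (m n : nat) :
  (m <= n)%N -> (forall i, (m <= i)%N -> G i = 0) ->
  \sum_(i < n) G i = \sum_(i < m) G i.
Proof.
move=> le_mn G0; rewrite -(subnKC le_mn) big_split_ord /=.
by rewrite [X in _ + X]big1 ?addr0 // => i _; rewrite G0 ?leq_addr.
Qed.

(** * The absolute trace of a finite field *)

Section AbsoluteTrace.

Variables (L : finFieldType) (p N : nat).
Hypotheses (p_pr : prime p) (cardL : #|L| = (p ^ N)%N).

Local Notation T := (abs_trace p N).

Let pcharL : p \in [pchar L] := card_finPcharP cardL p_pr.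

Let N_gt0 : (0 < N)%N.
Proof. by rewrite -(ltn_exp2l 0 N (prime_gt1 p_pr)) -cardL finNzRing_gt1. Qed.

Lemma exprDpX (i : nat) (x y : L) :
  (x + y) ^+ (p ^ i) = x ^+ (p ^ i) + y ^+ (p ^ i).
Proof.
by apply: exprDn_pchar; rewrite (eq_pnat _ (pcharf_eq pcharL)) pnatX pnat_id.
Qed.

Lemma abs_traceD (x y : L) : T (x + y) = T x + T y.
Proof.
by rewrite /abs_trace -big_split; apply: eq_bigr => i _; rewrite exprDpX.
Qed.

Lemma abs_trace0 : T (0 : L) = 0.
Proof. by apply: (addrI (T 0)); rewrite -abs_traceD !addr0. Qed.

Lemma abs_trace_sum (I : Type) (r : seq I) (P : pred I) (G : I -> L) :
  T (\sum_(i <- r | P i) G i) = \sum_(i <- r | P i) T (G i).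
Proof. exact: (big_morph _ abs_traceD abs_trace0). Qed.

(** Raising to the [p]-th power permutes the summands cyclically: the last one becomes
    [x ^+ (p ^ N)], which is [x] again. *)
Lemma abs_trace_Frobenius (i : nat) (x : L) : T (x ^+ (p ^ i)) = T x.
Proof.
elim: i x => [|i IHi] x; first by rewrite expn0 expr1.
rewrite expnSr exprM -[RHS]IHi.
move: (x ^+ _) => {IHi} {}x; rewrite /abs_trace.
case: N N_gt0 cardL => // M _ cL.
rewrite big_ord_recr [RHS]big_ord_recl /= expn0 expr1 [RHS]addrC -exprM -expnS.
rewrite -cL expf_card; congr (_ + x).
by apply: eq_bigr => j _; rewrite -exprM -expnS.
Qed.

Lemma abs_trace_expp (x : L) : T x ^+ p = T x.
Proof.
rewrite -[RHS](abs_trace_Frobenius 1) expn1 -!(pFrobenius_autE pcharL).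
rewrite /abs_trace rmorph_sum; apply: eq_bigr => i _.
by rewrite rmorphXn.
Qed.

(** The polynomial ['X^p - 'X] has at most [p] roots, and the images of the naturals below [p] are
    already [p] distinct ones. A further root [t] would be one too many. *)
Lemma prime_subfieldP (t : L) : t ^+ p = t -> exists k : 'I_p, k%:R = t.
Proof.
move=> tp; suff /existsP[k /eqP kt] : [exists k : 'I_p, k%:R == t] by exists k.
apply: contraT; rewrite negb_exists => /forallP t_nat.
pose P : {poly L} := 'X^p - 'X.
have sizeP : size P = p.+1.
  by rewrite /P size_polyDl size_polyXn // size_polyN size_polyX ltnS prime_gt1.
have P0 : P != 0 by rewrite -size_poly_eq0 sizeP.
have rootP x : x ^+ p = x -> root P x.
  by move=> xp; rewrite rootE !hornerE xp subrr.
pose s := t :: [seq (k : nat)%:R | k : 'I_p].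
have: (size s < size P)%N.
  apply: max_poly_roots => //.
    rewrite /= rootP //=; apply/allP => x /mapP[k _ ->]; apply: rootP.
    by rewrite -(pFrobenius_autE pcharL) pFrobenius_aut_nat.
  rewrite /=; apply/andP; split.
    apply/negP => /mapP[k _ tk]; have := t_nat k.
    by rewrite tk eqxx.
  (* If [i <= j] have the same image, then [p] divides [j - i < p], so [i = j]. *)
  rewrite map_inj_uniq ?enum_uniq // => i j; move=> ij.
  wlog le_ij : i j ij / (i <= j)%N.
    by move=> W; case/orP: (leq_total i j) => h; [|apply: esym]; apply: W.
  apply/val_inj/eqP; rewrite eqn_leq le_ij /= -subn_eq0.
  apply/eqP; have: (p %| j - i)%N.
    by rewrite (dvdn_pcharf pcharL) natrB // ij subrr.
  case: (posnP (j - i)%N) => // ji_gt0 /(dvdn_leq ji_gt0).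
  by rewrite leqNgt (leq_ltn_trans (leq_subr _ _)).
by rewrite sizeP /= size_map -cardE card_ord ltnn.
Qed.

Lemma prime_residue_lt (t : L) : (prime_residue p t < p)%N.
Proof. by rewrite /prime_residue; case: pickP => // _; apply: prime_gt0. Qed.

(** Traces are fixed by Frobenius, hence lie in the prime subfield, so the default branch of
    [prime_residue] is never reached on them. *)
Lemma prime_residue_trace (x : L) : (prime_residue p (T x))%:R = T x.
Proof.
rewrite /prime_residue; case: pickP => [k /eqP //|none].
have [k kx] := prime_subfieldP (abs_trace_expp x).
by have := none k; rewrite /= kx eqxx.
Qed.

Lemma prime_residue_trace_eq0 (x : L) : (prime_residue p (T x) == 0%N) = (T x == 0).
Proof.
apply/eqP/eqP => [res0|Tx0]; first by rewrite -prime_residue_trace res0.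
have: (p %| prime_residue p (T x))%N.
  by rewrite (dvdn_pcharf pcharL) prime_residue_trace Tx0.
case: (posnP (prime_residue p (T x))) => // r_gt0 /(dvdn_leq r_gt0).
by rewrite leqNgt prime_residue_lt.
Qed.

(* The trace is a polynomial map of degree [p ^ N.-1 < #|L|]. *)
Lemma abs_trace_nondegenerate (a : L) : (forall b, T (a * b) = 0) -> a = 0.
Proof.
move=> Ta0; apply/eqP; apply/negPn/negP => a0.
have T0 (x : L) : T x = 0 by rewrite -(mulVKf a0 x).
pose P : {poly L} := \sum_(i < N) 'X^(p ^ i).
have sizeP : size P = (p ^ N.-1).+1.
  rewrite /P -[in LHS](prednK N_gt0) big_ord_recr /= addrC size_polyDl size_polyXn //.
  apply: (leq_ltn_trans (size_sum _ _ _)); rewrite ltnS; apply/bigmax_leqP => i _.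
  by rewrite size_polyXn ltn_exp2l ?prime_gt1.
have P0 : P != 0 by rewrite -size_poly_eq0 sizeP.
have: (size (enum L) < size P)%N.
  apply: max_poly_roots; rewrite ?enum_uniq //; apply/allP => x _.
  rewrite rootE /P horner_sum -[X in _ == X](T0 x); apply/eqP.
  by apply: eq_bigr => i _; rewrite hornerXn.
by rewrite -cardE cardL sizeP ltnS leq_exp2l ?prime_gt1 // leqNgt prednK ?leqnn.
Qed.

End AbsoluteTrace.

(** * The action of polynomials over [F] on [L] *)

Section ModuleAction.

Variables (F : finFieldType) (L : fieldExtType F).
Implicit Types (g h : {poly F}) (a : L).

(** Padding with zero terms gives polynomials of different sizes a common range of summation. *)
Lemma poly_act_widen k g a : (size g <= k)%N ->
  poly_act g a = \sum_(i < k) g`_i *: a ^+ (#|F| ^ i).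
Proof.
move=> le_gk; symmetry.
apply: (sum_ord_trunc (G := fun i => g`_i *: a ^+ (#|F| ^ i)) le_gk) => i le_gi.
by rewrite nth_default ?scale0r.
Qed.

Lemma poly_actD g h a : poly_act (g + h) a = poly_act g a + poly_act h a.
Proof.
rewrite !(@poly_act_widen (maxn (size g) (size h))) ?size_polyD //.
- by rewrite -big_split; apply: eq_bigr => i _; rewrite coefD scalerDl.
- exact: leq_maxr.
- exact: leq_maxl.
Qed.

Lemma poly_actZ c g a : poly_act (c *: g) a = c *: poly_act g a.
Proof.
rewrite (@poly_act_widen (size g)) ?size_scale_leq // scaler_sumr.
by apply: eq_bigr => i _; rewrite coefZ scalerA.
Qed.

Lemma poly_act0 a : poly_act 0 a = 0.
Proof. by rewrite -(scale0r 0) poly_actZ scale0r. Qed.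

Lemma poly_act_sum (I : Type) (r : seq I) (P : pred I) (G : I -> {poly F}) a :
  poly_act (\sum_(i <- r | P i) G i) a = \sum_(i <- r | P i) poly_act (G i) a.
Proof.
apply: (big_morph (fun g => poly_act g a) _ (poly_act0 a)) => g h.
exact: poly_actD.
Qed.

Lemma poly_actXn k a : poly_act 'X^k a = a ^+ (#|F| ^ k).
Proof.
rewrite (@poly_act_widen k.+1) ?size_polyXn // big_ord_recr /= big1 => [|i _].
  by rewrite coefXn eqxx scale1r add0r.
by rewrite coefXn ltn_eqF ?scale0r.
Qed.

(** Scalars from [F] are fixed by the [#|F|]-th power map. *)
Lemma exprZ_card k (c : F) a : (c *: a) ^+ (#|F| ^ k) = c *: a ^+ (#|F| ^ k).
Proof.
rewrite exprZn; congr (_ *: _); elim: k => [|k IHk]; first by rewrite expr1.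
by rewrite expnSr exprM IHk expf_card.
Qed.

Lemma card_FinFieldExt : #|FinFieldExtType L| = (#|F| ^ \dim {:L})%N.
Proof. by rewrite -(card_vspace ({:finvect_type L})) card_vspacef. Qed.

Lemma expr_card_dim k a : a ^+ (#|F| ^ (\dim {:L} * k)) = a.
Proof.
have fix1 : a ^+ (#|F| ^ \dim {:L}) = a.
  rewrite -card_FinFieldExt; exact: (@expf_card (FinFieldExtType L) a).
by elim: k => [|k IHk]; rewrite ?muln0 ?expr1 // mulnS expnD exprM fix1.
Qed.

Lemma Fq_order_coef0 a f : has_Fq_order a f -> f`_0 != 0.
Proof.
case=> _ /(_ ('X^(\dim {:L}) - 1)) [f_dvd _].
have {}f_dvd : f %| 'X^(\dim {:L}) - 1.
  (* The polynomial ['X^(\dim {:L}) - 1] annihilates every element; its constant 1 is rewritten as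
     ['X^0], which acts as the identity. *)
  apply: f_dvd; rewrite -scaleN1r poly_actD poly_actZ poly_actXn -(expr0 'X).
  by rewrite poly_actXn -{1}(muln1 (\dim _)) expr_card_dim expr1 scaleN1r subrr.
(* Otherwise 0 would be a root of ['X^(\dim {:L}) - 1], whose value there is -1 because the
   dimension is positive. *)
rewrite -horner_coef0 -rootE -dvdp_XsubCl; apply/negP => /dvdp_trans/(_ f_dvd).
rewrite dvdp_XsubCl; apply/negP.
by rewrite rootE !hornerE expr0n gtn_eqF ?adim_gt0 // sub0r oppr_eq0 oner_eq0.
Qed.

End ModuleAction.

(** * Reversal of polynomials and divisibility *)

Section Reversal.

Variable F : fieldType.
Implicit Types (g h f : {poly F}).

(** This is x^M g(1/x) when deg g <= M; coefficients of higher degree are dropped. Fixing [M]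
    independently of [g] makes the map linear in [g]. *)
Definition rev_poly M g : {poly F} := \sum_(i < M.+1) g`_i *: 'X^(M - i).

Lemma size_rev_poly M g : (size (rev_poly M g) <= M.+1)%N.
Proof.
apply: (leq_trans (size_sum _ _ _)); apply/bigmax_leqP => i _.
by rewrite (leq_trans (size_scale_leq _ _)) // size_polyXn ltnS leq_subr.
Qed.

Lemma coef_rev_poly_max M g : (rev_poly M g)`_M = g`_0.
Proof.
rewrite coef_sum big_ord_recl /= coefZ coefXn subn0 eqxx mulr1 big1 ?addr0 //.
move=> i _; rewrite coefZ coefXn gtn_eqF ?mulr0 //.
by rewrite ltn_subrL /= (leq_ltn_trans _ (ltn_ord i)).
Qed.

Lemma rev_polyD M g h : rev_poly M (g + h) = rev_poly M g + rev_poly M h.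
Proof.
by rewrite /rev_poly -big_split; apply: eq_bigr => i _; rewrite coefD scalerDl.
Qed.

Lemma rev_polyZ M c g : rev_poly M (c *: g) = c *: rev_poly M g.
Proof.
by rewrite /rev_poly scaler_sumr; apply: eq_bigr => i _; rewrite coefZ scalerA.
Qed.

Lemma rev_poly0 M : rev_poly M 0 = 0.
Proof. by rewrite -(scale0r (0 : {poly F})) rev_polyZ !scale0r. Qed.

Lemma rev_poly_sum M (I : Type) (r : seq I) (P : pred I) (G : I -> {poly F}) :
  rev_poly M (\sum_(i <- r | P i) G i) = \sum_(i <- r | P i) rev_poly M (G i).
Proof. exact: (big_morph _ (rev_polyD M) (rev_poly0 M)). Qed.

Lemma rev_polyXn M k : (k <= M)%N -> rev_poly M 'X^k = 'X^(M - k).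
Proof.
rewrite -ltnS => ltkM; rewrite /rev_poly (bigD1 (Ordinal ltkM)) //= coefXn eqxx.
rewrite scale1r big1 ?addr0 // => i neq; rewrite coefXn.
by rewrite (_ : (i == k :> nat) = false) ?scale0r //; apply: negbTE.
Qed.

Lemma poly_widen M g : (size g <= M)%N -> g = \sum_(i < M) g`_i *: 'X^i.
Proof.
move=> le_gM; rewrite -{1}[g]coefK poly_def; symmetry.
apply: (sum_ord_trunc (G := fun i => g`_i *: 'X^i) le_gM) => i le_gi.
by rewrite nth_default ?scale0r.
Qed.

Lemma rev_polyK M g : (size g <= M.+1)%N -> rev_poly M (rev_poly M g) = g.
Proof.
move=> le_gM; rewrite {2}/rev_poly rev_poly_sum [RHS](poly_widen le_gM).
apply: eq_bigr => i _; rewrite rev_polyZ rev_polyXn ?leq_subr // subKn //.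
by rewrite -ltnS.
Qed.

(** By bilinearity it suffices to treat monomials, where (m + k) - (i + j) = (m - i) + (k - j). *)
Lemma rev_polyM m k g h : (size g <= m.+1)%N -> (size h <= k.+1)%N ->
  rev_poly (m + k) (g * h) = rev_poly m g * rev_poly k h.
Proof.
move=> /poly_widen {1}-> /poly_widen {1}->.
rewrite !mulr_suml rev_poly_sum; apply: eq_bigr => i _.
rewrite !mulr_sumr rev_poly_sum; apply: eq_bigr => j _.
have [lei lej] : (i <= m)%N /\ (j <= k)%N by split; rewrite -ltnS.
rewrite -!scalerAl -!scalerAr !rev_polyZ -!exprD rev_polyXn ?leq_add //.
by rewrite addnBA // addnBAC // subnDA.
Qed.

(** When g = h f, the reversal of [g] at [M] is the reversal of [h] at [M - m] times that of [f] at
    [m]. *)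
Lemma rev_poly_dvd m M f g : size f = m.+1 -> (size g <= M.+1)%N ->
  f %| g -> rev_poly m f %| rev_poly M g.
Proof.
move=> sizef leg /dvdpP[h gE].
have [h0|h0] := eqVneq h 0; first by rewrite gE h0 mul0r rev_poly0 dvdp0.
have f0 : f != 0 by rewrite -size_poly_eq0 sizef.
move: leg; rewrite gE size_mul // sizef addnS /= => leg.
have hgt0 : (0 < size h)%N by rewrite lt0n size_poly_eq0.
have lemM : (m <= M)%N.
  by rewrite -ltnS (leq_trans _ leg) // -add1n leq_add2r.
rewrite -{1}(subnK lemM) rev_polyM ?sizef //.
  by rewrite dvdp_mulIr.
by rewrite -subSn // leq_subRL ?(leqW lemM) // addnC.
Qed.

Lemma monic_reciprocalE f : f != 0 ->
  monic_reciprocal f = (f`_0)^-1 *: rev_poly (size f).-1 f.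
Proof.
by move=> f0; rewrite /monic_reciprocal /rev_poly prednK // lt0n size_poly_eq0.
Qed.

(** The top coefficient of the reversal is f(0), so the degree does not drop. *)
Lemma size_rev_poly_coef0 f :
  f`_0 != 0 -> size (rev_poly (size f).-1 f) = size f.
Proof.
move=> f00; have f0 : (0 < size f)%N.
  by rewrite lt0n size_poly_eq0; apply: contraNneq f00 => ->; rewrite coef0.
apply/eqP; rewrite eqn_leq -{2 3}(prednK f0) size_rev_poly /=.
rewrite ltnNge; apply: contra f00 => le_size.
by rewrite -(coef_rev_poly_max (size f).-1) nth_default.
Qed.

Lemma monic_reciprocal_monic f : f`_0 != 0 -> monic_reciprocal f \is monic.
Proof.
move=> f00; have f0 : f != 0 by apply: contraNneq f00 => ->; rewrite coef0.
rewrite monic_reciprocalE // monicE lead_coefZ lead_coefE size_rev_poly_coef0 //.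
by rewrite coef_rev_poly_max mulVf.
Qed.

(** Reversal preserves divisibility and is an involution at a fixed bound, so each direction follows
    from the other by reversing both sides. *)
Lemma dvd_monic_reciprocal M f g : f`_0 != 0 -> (size g <= M.+1)%N ->
  (monic_reciprocal f %| g) = (f %| rev_poly M g).
Proof.
move=> f00 leg; have f0 : f != 0 by apply: contraNneq f00 => ->; rewrite coef0.
have sizef : size f = (size f).-1.+1 by rewrite prednK // lt0n size_poly_eq0.
rewrite monic_reciprocalE // dvdpZl ?invr_eq0 //; apply/idP/idP => dvd.
  rewrite -[f](@rev_polyK (size f).-1) -?sizef //.
  by apply: rev_poly_dvd; rewrite ?size_rev_poly_coef0.
rewrite -[g](rev_polyK leg).
by apply: rev_poly_dvd; rewrite ?size_rev_poly.
Qed.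

End Reversal.

(** * Triviality of the characters and the adjoint of the action *)

Lemma cexp_root_of_unity_eq1 (R : realType) (p k : nat) : (k < p)%N ->
  cexp (((2 * pi : R)%:C * 'i * k%:R) / p%:R)%C = 1 <-> k = 0%N.
Proof.
move=> lt_kp; have p_gt0 : (0 < p)%N by apply: leq_ltn_trans lt_kp.
have -> : (((2 * pi : R)%:C * 'i * k%:R) / p%:R)%C
    = (0 +i* (2 * pi * k%:R / p%:R))%C.
  rewrite -!(rmorph_nat (real_complex R)) -fmorphV.
  by simpc.
rewrite /cexp /= expR0 mul1r.
split=> [[cos1 _]|->]; last by rewrite mulr0 mul0r cos0 sin0.
apply/eqP; apply: contraT; rewrite -lt0n => k_gt0.
(* The half angle [t] lies strictly between 0 and [pi], so [sin t] is positive, whereas cos(2t) = 1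
   - 2 sin(t)^2 = 1 would make it vanish. *)
pose t : R := pi * k%:R / p%:R.
have : 0 < sin t.
  apply: sin_gt0_pi; rewrite !mulr_gt0 ?pi_gt0 ?invr_gt0 ?ltr0n //=.
  by rewrite ltr_pdivrMr ?ltr0n // ltr_pM2l ?pi_gt0 // ltr_nat.
have : cos (t *+ 2) = 1 by rewrite -mulr_natl /t !mulrA.
rewrite cos_mulr2n cos2sin2 => cost sint.
have /eqP : sin t ^+ 2 = 0 by lra.
by rewrite expf_eq0 /= gt_eqF.
Qed.

Lemma add_char_eq1 (R : realType) (L : finFieldType) (p N : nat) (a b : L) :
  prime p -> #|L| = (p ^ N)%N ->
  add_char R p N a b = 1 <-> abs_trace p N (a * b) = 0.
Proof.
move=> p_pr cardL; rewrite /add_char cexp_root_of_unity_eq1 ?prime_residue_lt //.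
have E := prime_residue_trace_eq0 p_pr cardL (a * b).
by split=> /eqP t0; apply/eqP; rewrite ?E // -E.
Qed.

(* Raising to the [#|F| ^ (M - i)]-th power preserves the trace, and maps
   [a * b ^+ (#|F| ^ i)] to [a ^+ (#|F| ^ (M - i)) * b]. *)
Lemma abs_trace_adjoint (p s k : nat) (F : finFieldType) (L : fieldExtType F)
    (g : {poly F}) (a b : L) (M := (\dim {:L} * k)%N) :
  prime p -> #|F| = (p ^ s)%N -> (size g <= M.+1)%N ->
  abs_trace p (\dim {:L} * s) (a * poly_act g b)
  = abs_trace p (\dim {:L} * s) (poly_act (rev_poly M g) a * b).
Proof.
move=> p_pr cardF leg.
have cardL : #|FinFieldExtType L| = (p ^ (\dim {:L} * s))%N.
  by rewrite card_FinFieldExt cardF -expnM mulnC.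
rewrite (poly_act_widen _ leg) poly_act_sum mulr_sumr mulr_suml.
rewrite !(abs_trace_sum p_pr cardL); apply: eq_bigr => i _.
rewrite -(abs_trace_Frobenius p_pr cardL (s * (M - i))) expnM -cardF.
rewrite -scalerAr exprZ_card exprMn -exprM -expnD subnKC -1?ltnS //.
by rewrite expr_card_dim poly_actZ poly_actXn scalerAl.
Qed.

Theorem theorem1 (R : realType) (p s n : nat) (F : finFieldType)
    (L : fieldExtType F) (alpha : L) (f : {poly F}) :
  prime p -> (0 < s)%N -> #|F| = (p ^ s)%N ->
  (0 < n)%N -> \dim {:L} = n ->
  has_Fq_order alpha f ->
  has_Fq_order_char (@add_char R L p (n * s) alpha) (monic_reciprocal f).
Proof.
move=> p_pr _ cardF n_gt0 dimL ordf.
have f00 := Fq_order_coef0 ordf; have [_ f_dvd] := ordf.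
split=> [|g]; first exact: monic_reciprocal_monic.
(* The bound [\dim {:L} * size g] is a multiple of the dimension, as the adjoint formula requires,
   and large enough to reverse [g] without loss. *)
have leg : (size g <= (\dim {:L} * size g).+1)%N.
  by rewrite leqW // leq_pmull // dimL.
rewrite (dvd_monic_reciprocal f00 leg) -f_dvd -dimL.
have cardL : #|FinFieldExtType L| = (p ^ (\dim {:L} * s))%N.
  by rewrite card_FinFieldExt cardF -expnM mulnC.
have charE b : char_act g (@add_char R L p (\dim {:L} * s) alpha) b = 1
    <-> abs_trace p (\dim {:L} * s)
          (poly_act (rev_poly (\dim {:L} * size g) g) alpha * b) = 0.
  rewrite -(abs_trace_adjoint _ _ p_pr cardF leg).
  (* [FinFieldExtType L] is [L] itself equipped with its finite field structure, so the statement
     for finite fields applies up to conversion. *)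
  exact: (@add_char_eq1 R (FinFieldExtType L) p _ _ _ p_pr cardL).
split=> [chi1|act0 b]; last by apply/charE; rewrite act0 mul0r (abs_trace0 p_pr cardL).
by apply: (abs_trace_nondegenerate p_pr cardL) => b; apply/charE.
Qed.
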